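(* Let $P_1=EENN$ and $P_6=NNEE$, and let $$F_{1,6}(x_1,x_6,t)=1+\sum_{n\ge 1}t^n\sum_{L\in\mathcal{L}_n}x_1^{P_1\text{-mch}(L)}x_6^{P_6\text{-mch}(L)}.$$ Then $$F_{1,6}(x_1,x_6,t)=\frac{2x_1x_6}{\left(-1+\sqrt{1-4x_1t}\right)x_6+\left(-1+\sqrt{1-4x_6t}\right)x_1+2x_1x_6}.$$
   Context: $\mathcal{L}_n$ is the set of lattice paths from $(0,0)$ to $(n,n)$ consisting of unit north steps $N$ and unit east steps $E$, equivalently words with $n$ letters $E$ and $n$ letters $N$. For $L\in\mathcal{L}_n$ and $A\subseteq\{1,\dots,n\}$, $ps_L(A)$ is the word obtained from $L$ by deleting, for every $i\in\{1,\dots,n\}\setminus A$, the $i$-th occurrence of $E$ and the $i$-th occurrence of $N$ (reading from left to right). For $P\in\mathcal{L}_2$, $P\text{-mch}(L)$ is the number of $j\in\{1,\dots,n-1\}$ with $ps_L(\{j,j+1\})=P$. Identities are between formal power series in $t$ with coefficients polynomial in $x_1,x_6$ (quotients taken in the fraction field); square roots denote the formal power series square roots with constant term $1$. *)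

(* Defs.v *)
From HB Require Import structures.
From mathcomp Require Import all_boot all_algebra boolp classical_sets mpoly.

Set Implicit Arguments.
Unset Strict Implicit.
Unset Printing Implicit Defensive.

Import GRing.Theory.
Local Open Scope ring_scope.

(* [fps R] is the ring R[[t]] of formal power series, given by their
   coefficient sequences, with the Cauchy product. *)
Record fps (R : Type) : Type := Fps { fps_coef : nat -> R }.

HB.instance Definition _ (R : Type) := gen_eqMixin (fps R).
HB.instance Definition _ (R : Type) := gen_choiceMixin (fps R).

Lemma fps_ext (R : Type) (f g : fps R) : fps_coef f =1 fps_coef g -> f = g.
Proof. by case: f g => [f] [g] /= /funext ->. Qed.

Section FpsZmodule.
Variable R : zmodType.
Implicit Types f g h : fps R.

Definition fps_zero : fps R := Fps (fun=> 0).
Definition fps_opp f : fps R := Fps (fun n => - fps_coef f n).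
Definition fps_add f g : fps R := Fps (fun n => fps_coef f n + fps_coef g n).

Fact fps_addA : associative fps_add.
Proof. by move=> f g h; apply: fps_ext => n /=; rewrite addrA. Qed.
Fact fps_addC : commutative fps_add.
Proof. by move=> f g; apply: fps_ext => n /=; rewrite addrC. Qed.
Fact fps_add0 : left_id fps_zero fps_add.
Proof. by move=> f; apply: fps_ext => n /=; rewrite add0r. Qed.
Fact fps_addN : left_inverse fps_zero fps_opp fps_add.
Proof. by move=> f; apply: fps_ext => n /=; rewrite addNr. Qed.

HB.instance Definition _ :=
  GRing.isZmodule.Build (fps R) fps_addA fps_addC fps_add0 fps_addN.

End FpsZmodule.

Section FpsRing.
Variable R : comNzRingType.
Implicit Types f g h : fps R.

(* Also the embedding of the constant series. *)
Definition fpsC (c : R) : fps R := Fps (fun n => if n == 0%N then c else 0).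
Definition fpsT : fps R := Fps (fun n => (n == 1%N)%:R).
Definition fps_mul f g : fps R :=
  Fps (fun n => \sum_(i < n.+1) fps_coef f i * fps_coef g (n - i)).

Let tr n f : {poly R} := \poly_(i < n.+1) fps_coef f i.

Let coef_mulE n k f g (p q : {poly R}) : (k <= n)%N ->
  (forall i, (i <= n)%N -> p`_i = fps_coef f i) ->
  (forall i, (i <= n)%N -> q`_i = fps_coef g i) ->
  (p * q)`_k = fps_coef (fps_mul f g) k.
Proof.
move=> kn Ep Eq; rewrite coefM /=; apply: eq_bigr => i _.
rewrite Ep ?Eq //; first exact: leq_trans (leq_subr _ _) kn.
by apply: leq_trans kn; rewrite -ltnS.
Qed.

Let coef_tr n f i : (i <= n)%N -> (tr n f)`_i = fps_coef f i.
Proof. by move=> le_in; rewrite coef_poly ltnS le_in. Qed.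

Fact fps_mulA : associative fps_mul.
Proof.
move=> f g h; apply: fps_ext => n.
rewrite -(coef_mulE (n := n) (p := tr n f) (q := tr n g * tr n h)) //; first last.
- by move=> i le_in; apply: (coef_mulE le_in) => j; apply: coef_tr.
- by move=> i; apply: coef_tr.
rewrite mulrA; apply: (coef_mulE (n := n)) => // i le_in; last exact: coef_tr.
by apply: (coef_mulE le_in) => j; apply: coef_tr.
Qed.

Fact fps_mulC : commutative fps_mul.
Proof.
move=> f g; apply: fps_ext => n.
rewrite -(coef_mulE (leqnn n) (@coef_tr n f) (@coef_tr n g)) mulrC.
exact: (coef_mulE (leqnn n) (@coef_tr n g) (@coef_tr n f)).
Qed.

Fact fps_mul1 : left_id (fpsC 1) fps_mul.
Proof.
move=> f; apply: fps_ext => n /=.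
rewrite big_ord_recl /= mul1r subn0 big1 ?addr0 // => i _.
by rewrite mul0r.
Qed.

Fact fps_mulDl : left_distributive fps_mul (@fps_add R).
Proof.
move=> f g h; apply: fps_ext => n /=.
by rewrite -big_split /=; apply: eq_bigr => i _; rewrite mulrDl.
Qed.

Fact fps_oner_neq0 : fpsC 1 != 0 :> fps R.
Proof.
by apply/eqP => /(congr1 (fun f => fps_coef f 0)) /= /eqP; rewrite oner_eq0.
Qed.

HB.instance Definition _ := GRing.Zmodule_isComNzRing.Build (fps R)
  fps_mulA fps_mulC fps_mul1 fps_mulDl fps_oner_neq0.

Definition fps_unit : pred (fps R) := fun f => `[< exists g, g * f = 1 >].
Definition fps_inv f : fps R :=
  if pselect (exists g, g * f = 1) is left ex then projT1 (cid ex) else f.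

Fact fps_mulV : {in fps_unit, left_inverse 1 fps_inv *%R}.
Proof.
move=> f /asboolP ex; rewrite /fps_inv; case: pselect => // ex'.
exact: projT2 (cid ex').
Qed.
Fact fps_unitP f g : g * f = 1 -> fps_unit f.
Proof. by move=> gf1; apply/asboolP; exists g. Qed.
Fact fps_inv_out : {in [predC fps_unit], fps_inv =1 id}.
Proof.
move=> f /negP nf; rewrite /fps_inv; case: pselect => // ex.
by case: nf; apply/asboolP.
Qed.

HB.instance Definition _ := GRing.ComNzRing_hasMulInverse.Build (fps R)
  fps_mulV fps_unitP fps_inv_out.

(* The formal power series square root of [f] with constant term 1 (and 0 when
   there is none); see [fps_sqrtP] and [fps_sqrt_unique] below. *)
Definition fps_sqrt f : fps R :=
  xget 0 [set s : fps R | s ^+ 2 = f /\ fps_coef s 0 = 1].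

End FpsRing.

Section FpsIdomain.
Variable R : idomainType.
Implicit Types f g s : fps R.

Let fps_neq0 f : f != 0 ->
  exists2 m, fps_coef f m != 0 & forall i, (i < m)%N -> fps_coef f i = 0.
Proof.
move=> nzf; have ex : exists m, fps_coef f m != 0.
  apply: contrapT => nex; case/eqP: nzf; apply: fps_ext => m /=.
  by apply/eqP; apply: contrapT => /negP nz; apply: nex; exists m.
exists (ex_minn ex); case: ex_minnP => // m _ min_m i lt_im.
by apply/eqP; apply: contraTT lt_im => /min_m; rewrite -leqNgt.
Qed.

Fact fps_mulf_eq0 f g : f * g = 0 -> (f == 0) || (g == 0).
Proof.
apply: contra_eqT; rewrite negb_or => /andP[/fps_neq0[m fm ltm] /fps_neq0[k gk ltk]].
apply/eqP => /(congr1 (fun h => fps_coef h (m + k))) /= /eqP.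
have ltmk : (m < (m + k).+1)%N by rewrite ltnS leq_addr.
rewrite (bigD1 (Ordinal ltmk)) //= addKn big1 ?addr0 => [|i].
  by rewrite mulf_eq0 (negPf fm) (negPf gk).
rewrite -val_eqE /= neq_ltn => /orP[/ltm->|lt_mi]; first by rewrite mul0r.
by rewrite (ltk (m + k - i)%N) ?mulr0 // ltn_subLR ?ltn_add2r // -ltnS.
Qed.

HB.instance Definition _ :=
  GRing.ComUnitRing_isIntegral.Build (fps R) fps_mulf_eq0.

Section Sqrt.
Hypothesis unit2 : (2%:R : R) \is a GRing.unit.

Lemma fps_sqrt_unique f s :
  s ^+ 2 = f -> fps_coef s 0 = 1 -> fps_sqrt f = s.
Proof.
move=> s2f s01; apply: xget_unique => // s' [s'2f s'01].
have /eqP := etrans s'2f (esym s2f).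
rewrite eqf_sqr => /orP[/eqP//|/eqP s'N]; have := s'01.
rewrite s'N /= s01 => /eqP; rewrite eq_sym -subr_eq0 opprK => /eqP two0.
by move: unit2; rewrite mulr2n two0 unitr0.
Qed.

Let sqrt_next f (l : seq R) : R :=
  let n := size l in
  if n == 0%N then 1 else
  2%:R^-1 * (fps_coef f n - \sum_(1 <= i < n) l`_i * l`_(n - i)).
Let sqrt_seq f n : seq R := iter n (fun l => rcons l (sqrt_next f l)) [::].

Let size_sqrt_seq f n : size (sqrt_seq f n) = n.
Proof. by elim: n => //= n IHn; rewrite size_rcons IHn. Qed.

Let nth_sqrt_seq f n i : (i < n)%N -> (sqrt_seq f n)`_i = sqrt_next f (sqrt_seq f i).
Proof.
elim: n => // n IHn; rewrite ltnS leq_eqVlt /= nth_rcons size_sqrt_seq.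
by case/orP=> [/eqP->|lt_in]; rewrite ?ltnn ?eqxx // lt_in IHn.
Qed.

Lemma fps_sqrtP f : fps_coef f 0 = 1 ->
  fps_sqrt f ^+ 2 = f /\ fps_coef (fps_sqrt f) 0 = 1.
Proof.
move=> f01; rewrite /fps_sqrt.
apply: (@xgetPex _ _ [set s : fps R | s ^+ 2 = f /\ fps_coef s 0 = 1]).
pose a n := sqrt_next f (sqrt_seq f n).
have a0 : a 0%N = 1 by [].
exists (Fps a); split => //; rewrite expr2; apply: fps_ext => -[|n] /=.
  by rewrite big_ord1 !a0 mul1r f01.
rewrite big_ord_recl big_ord_recr /= subn0 /bump /= add1n subnn a0 mul1r mulr1.
have aS : a n.+1 = 2%:R^-1 * (fps_coef f n.+1 - \sum_(i < n) a (1 + i)%N * a (n.+1 - (1 + i))%N).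
  rewrite {1}/a {1}/sqrt_next size_sqrt_seq big_add1 big_mkord.
  congr (_ * (_ - _)); apply: eq_bigr => i _.
  by rewrite add1n !nth_sqrt_seq ?ltnS // subSS leq_subr.
set S := (X in _ + (X + _)); rewrite -/S in aS *.
rewrite addrCA -mulr2n -mulr_natl aS mulVKr //.
by rewrite addrC subrK.
Qed.

End Sqrt.
End FpsIdomain.

(* Lattice paths are words over [bool]: [true] is an east step. *)
Definition stepE : bool := true.
Definition stepN : bool := false.

Definition lattice_paths (n : nat) : {set (n + n).-tuple bool} :=
  [set L : (n + n).-tuple bool |
    (count_mem stepE L == n) && (count_mem stepN L == n)].

(* The letter [L_k] is the [count_mem L_k (take k.+1 L)]-th occurrence of its
   kind in [L] (counting from 1); it is kept iff this index is in [A]. *)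
Definition ps (L : seq bool) (A : pred nat) : seq bool :=
  mask [seq A (count_mem (nth stepE L k) (take k.+1 L)) | k <- iota 0 (size L)] L.

Definition mch (P : seq bool) (n : nat) (L : (n + n).-tuple bool) : nat :=
  count (fun j => ps L (pred2 j j.+1) == P) (index_iota 1 n).

Definition P1 : seq bool := [:: stepE; stepE; stepN; stepN].
Definition P6 : seq bool := [:: stepN; stepN; stepE; stepE].

(* Variable 0 stands for x_1 and variable 1 for x_6. *)
Definition coefRing := {mpoly rat[2]}.
Definition x1 : coefRing := 'X_(inord 0 : 'I_2).
Definition x6 : coefRing := 'X_(inord 1 : 'I_2).

Definition F16 : fps coefRing :=
  Fps (fun n => if n == 0%N then 1
    else \sum_(L : (n + n).-tuple bool | L \in lattice_paths n)
      x1 ^+ mch P1 L * x6 ^+ mch P6 L).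

(* Main.v *)
(* The factor ps_L({j,j+1}) is EENN exactly when the (j+1)-st E precedes the j-th
   N, that is, when the j-th N step ends strictly below the diagonal; likewise
   NNEE marks the E steps ending strictly above it.  So every path is weighted
   by its steps, and a sequence of primitive excursions below (above) the
   diagonal gives F = 1 / (1 - t C(x1 t) - t C(x6 t)) with C the Catalan series.
   The excursions are not cut out explicitly: the series of the paths starting at
   a given distance from the diagonal satisfy linear recurrences that determine
   them. *)
Require Import Defs.
From HB Require Import structures.
From mathcomp Require Import all_boot all_algebra boolp mpoly.
From mathcomp Require Import zify ring.

Set Implicit Arguments.
Unset Strict Implicit.
Unset Printing Implicit Defensive.

Import GRing.Theory.
Local Open Scope ring_scope.

(** * Coefficients of power series and the Catalan series *)

Section Fps.
Variable R : comNzRingType.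
Implicit Types (f g : fps R) (x c : R) (n h : nat).
Local Notation t := (fpsT R).

Lemma fps_coefD f g n : fps_coef (f + g) n = fps_coef f n + fps_coef g n.
Proof. by []. Qed.

Lemma fps_coefM f g n :
  fps_coef (f * g) n = \sum_(i < n.+1) fps_coef f i * fps_coef g (n - i).
Proof. by []. Qed.

Lemma fps_coef1 n : fps_coef (1 : fps R) n = (n == 0%N)%:R.
Proof. by case: n. Qed.

Lemma fps_coefCM c f n : fps_coef (fpsC c * f) n = c * fps_coef f n.
Proof.
rewrite /= big_ord_recl subn0 /= big1 ?addr0 // => i _.
by rewrite mul0r.
Qed.

Lemma fps_coefTM f n :
  fps_coef (t * f) n = if n is m.+1 then fps_coef f m else 0.
Proof.
case: n => [|n]; first by rewrite /= big_ord1 mul0r.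
rewrite /= big_ord_recl big_ord_recl big1 => [|i _]; last by rewrite mul0r.
by rewrite /= mul0r add0r mul1r addr0 subSS subn0.
Qed.

(** The Catalan convolution is not structurally recursive in [n], so [k] serves as fuel; any [k]
    above [n] gives the same value. *)
Fixpoint catalan_iter x k n : R :=
  if k is k'.+1 then
    if n is n'.+1 then
      x * \sum_(i < n'.+1) catalan_iter x k' i * catalan_iter x k' (n' - i)
    else 1
  else 0.

Lemma catalan_iterS x k n : catalan_iter x k.+1 n.+1 =
  x * \sum_(i < n.+1) catalan_iter x k i * catalan_iter x k (n - i).
Proof. by []. Qed.

Lemma catalan_iter_stable x k l n :
  (n < k)%N -> (n < l)%N -> catalan_iter x k n = catalan_iter x l n.
Proof.
elim: k l n => // k IHk [|l] [|n] //= nk nl; congr (_ * _).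
by apply: eq_bigr => i _; have := ltn_ord i => lti; rewrite !(IHk l) //; lia.
Qed.

(* C(x t), for C the generating series of the Catalan numbers. *)
Definition catalan x : fps R := Fps (fun n => catalan_iter x n.+1 n).

Lemma fps_coef_catalan x n : fps_coef (catalan x) n = catalan_iter x n.+1 n.
Proof. by []. Qed.

Lemma catalanE x : catalan x = 1 + fpsC x * (t * (catalan x * catalan x)).
Proof.
apply: fps_ext => n; rewrite fps_coefD fps_coefCM fps_coefTM fps_coef1.
case: n => [|n]; first by rewrite mulr0 addr0.
rewrite add0r fps_coefM [LHS]catalan_iterS; congr (_ * _).
apply: eq_bigr => i _; rewrite !fps_coef_catalan.
have := ltn_ord i => lti.
by congr (_ * _); apply: catalan_iter_stable; lia.
Qed.

(* The recurrence says that the errors d_h = g_(h+1) - x^h C^(h+1) g_0 satisfy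
   d_0 = t d_1 and d_(h+1) = t d_(h+2) + x d_h, which forces d = 0. *)
Lemma catalan_ladder x (g : nat -> fps R) :
    g 1%N = t * g 2%N + g 0%N ->
    (forall h, g h.+2 = t * g h.+3 + fpsC x * g h.+1) ->
  g 1%N = catalan x * g 0%N.
Proof.
set C := catalan x => g1 gSS.
pose d h := g h.+1 - fpsC x ^+ h * C ^+ h.+1 * g 0%N.
have CE : C = 1 + fpsC x * (t * (C * C)) by exact: catalanE.
have d0 : d 0%N = t * d 1%N.
  by rewrite /d g1 !expr0 expr1 expr2 mul1r {1}CE; ring.
have dS h : d h.+1 = t * d h.+2 + fpsC x * d h.
  rewrite /d gSS !exprS.
  (* Only one factor [C] is expanded by its functional equation. *)
  have -> : fpsC x * fpsC x ^+ h * (C * (C * C ^+ h)) * g 0%N =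
      fpsC x * fpsC x ^+ h * ((1 + fpsC x * (t * (C * C))) * (C * C ^+ h)) * g 0%N.
    by rewrite -CE.
  ring.
(* The factor [t] lowers the coefficient index [n] and the other term lowers [h], hence the nested
   induction with [n] outermost. *)
have dE n h : fps_coef (d h) n = 0.
  elim: n h => [|n IHn]; elim=> [|h IHh].
  - by rewrite d0 fps_coefTM.
  - by rewrite dS fps_coefD fps_coefTM fps_coefCM IHh mulr0 addr0.
  - by rewrite d0 fps_coefTM IHn.
  - by rewrite dS fps_coefD fps_coefTM fps_coefCM IHh mulr0 addr0 IHn.
have : d 0%N = 0 by apply: fps_ext => n; rewrite dE.
by rewrite /d expr0 expr1 mul1r => /eqP; rewrite subr_eq0 => /eqP.
Qed.

End Fps.

(** Completing the square in C = 1 + x t C^2: the square of 1 - 2 x t C is 1 - 4 x t (C - x t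
    C^2). *)
Lemma fps_sqrt_catalan (R : idomainType) (x : R) :
    (2%:R : R) \is a GRing.unit ->
  fps_sqrt (1 - 4 * fpsC x * fpsT R) = 1 - 2 * fpsC x * fpsT R * catalan x.
Proof.
move=> u2; apply: fps_sqrt_unique => //; last first.
  have -> : 1 - 2 * fpsC x * fpsT R * catalan x =
            1 + fpsT R * (- (2 * fpsC x * catalan x)) by ring.
  by rewrite fps_coefD fps_coefTM addr0.
have CE := catalanE x; set C := catalan x in CE *.
have -> : 1 - 4 * fpsC x * fpsT R =
   1 - 4 * fpsC x * fpsT R * (C - fpsC x * (fpsT R * (C * C))).
  by rewrite {1}CE; ring.
ring.
Qed.

(** * Weighted lattice paths and their first-step recurrences *)

Section PathSum.
Variables (R : comNzRingType) (x y : R).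
Local Notation t := (fpsT R).

(* The paths counted here end on the diagonal, so the side on which a step ends
   is read off the letters that follow it. *)
Fixpoint lower_steps (L : seq bool) : nat :=
  if L is c :: L' then
    (((c == stepN) && (count_mem stepE L' < count_mem stepN L')) + lower_steps L')%N
  else 0%N.

Fixpoint upper_steps (L : seq bool) : nat :=
  if L is c :: L' then
    (((c == stepE) && (count_mem stepN L' < count_mem stepE L')) + upper_steps L')%N
  else 0%N.

Definition path_weight (L : seq bool) : R :=
  x ^+ lower_steps L * y ^+ upper_steps L.

(** The length is kept apart from [a + b], so that removing a first letter of either kind needs no
    cast between tuple types. *)
Definition word_sum (m a b : nat) (f : seq bool -> R) : R :=
  \sum_(L : m.-tuple bool | (count_mem stepE L == a) && (count_mem stepN L == b))
    f L.

Lemma eq_word_sum m a b (f g : seq bool -> R) :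
    (forall L, count_mem stepE L = a -> count_mem stepN L = b -> f L = g L) ->
  word_sum m a b f = word_sum m a b g.
Proof. by move=> fg; apply: eq_bigr => L /andP[/eqP La /eqP Lb]; apply: fg. Qed.

Lemma word_sumZ m a b c (f : seq bool -> R) :
  word_sum m a b (fun L => c * f L) = c * word_sum m a b f.
Proof. by rewrite /word_sum big_distrr. Qed.

Lemma word_sum0 (f : seq bool -> R) : word_sum 0 0 0 f = f [::].
Proof.
rewrite /word_sum (bigD1 [tuple]) //= big1 ?addr0 // => L.
by move=> /andP[_ /eqP[]]; exact: tuple0.
Qed.

Lemma word_sumS m a b (f : seq bool -> R) :
  word_sum m.+1 a b f =
    (if a is a'.+1 then word_sum m a' b (fun L => f (stepE :: L)) else 0) +
    (if b is b'.+1 then word_sum m a b' (fun L => f (stepN :: L)) else 0).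
Proof.
rewrite /word_sum.
rewrite (reindex (fun p : bool * m.-tuple bool => [tuple of p.1 :: p.2])) /=;
  last first.
  exists (fun L => (thead L, [tuple of behead L])) => [[c L]|L] _ /=.
    by congr (_, _); apply: val_inj.
  by rewrite [in RHS](tuple_eta L).
rewrite -(pair_big_dep predT (fun c (L : m.-tuple bool) =>
   (((c == stepE) + count_mem stepE L)%N == a) &&
   (((c == stepN) + count_mem stepN L)%N == b)) (fun c (L : m.-tuple bool) => f (c :: L))) /=.
rewrite big_bool /=; congr (_ + _).
  by case: a => [|a]; [apply: big_pred0 => L | apply: eq_bigl => L].
case: b => [|b]; first by apply: big_pred0 => L; rewrite andbF.
by apply: eq_bigl => L.
Qed.

Definition path_sum (a b : nat) : R := word_sum (a + b) a b path_weight.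

Lemma path_sumE m a b : (a + b = m)%N -> path_sum a b = word_sum m a b path_weight.
Proof. by move=> <-. Qed.

Lemma word_sum_weight_E m a b :
  word_sum m a b (fun L => path_weight (stepE :: L)) =
  y ^+ (b < a) * word_sum m a b path_weight.
Proof.
rewrite -word_sumZ; apply: eq_word_sum => L La Lb.
by rewrite /path_weight /= La Lb add0n exprD mulrCA.
Qed.

Lemma word_sum_weight_N m a b :
  word_sum m a b (fun L => path_weight (stepN :: L)) =
  x ^+ (a < b) * word_sum m a b path_weight.
Proof.
rewrite -word_sumZ; apply: eq_word_sum => L La Lb.
by rewrite /path_weight /= La Lb add0n exprD mulrA.
Qed.

Lemma path_sum00 : path_sum 0 0 = 1.
Proof. by rewrite /path_sum word_sum0 /path_weight mulr1. Qed.

Lemma path_sumSS a b : path_sum a.+1 b.+1 =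
  y ^+ (b.+1 < a) * path_sum a b.+1 + x ^+ (a.+1 < b) * path_sum a.+1 b.
Proof.
rewrite {1}/path_sum addSn word_sumS word_sum_weight_E word_sum_weight_N.
by rewrite -!path_sumE //; lia.
Qed.

Lemma path_sum0S b : path_sum 0 b.+1 = x ^+ (0 < b) * path_sum 0 b.
Proof. by rewrite {1}/path_sum word_sumS add0r word_sum_weight_N -path_sumE. Qed.

Lemma path_sumS0 a : path_sum a.+1 0 = y ^+ (0 < a) * path_sum a 0.
Proof.
by rewrite {1}/path_sum addSn word_sumS addr0 word_sum_weight_E -path_sumE.
Qed.

Definition path_series : fps R := Fps (fun n => path_sum n n).

(** Let [g h] count the paths that start [h] below the diagonal. A first step E leads to [h.+1],
    unweighted, and costs a factor [t]; a first step N leads to [h.-1] with weight [x], unless it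
    lands on the diagonal. This is the recurrence of [catalan_ladder]. *)
Lemma path_series_lower :
  Fps (fun a => path_sum a a.+1) = catalan x * path_series.
Proof.
pose g h := Fps (fun a => path_sum a (a + h)).
have -> : path_series = g 0%N by apply: fps_ext => a; rewrite /= addn0.
have -> : Fps (fun a => path_sum a a.+1) = g 1%N.
  by apply: fps_ext => a; rewrite /= addn1.
apply: catalan_ladder => [|h]; apply: fps_ext => -[|a];
  rewrite fps_coefD fps_coefTM ?fps_coefCM /=.
- by rewrite path_sum0S mul1r add0r.
- rewrite !addnS !addn0 path_sumSS ltnn.
  have -> : (a.+2 < a)%N = false by lia.
  by rewrite !mul1r.
- by rewrite !add0n path_sum0S add0r expr1.
- rewrite addnS path_sumSS !addnS !addSn.
  have -> : ((a + h).+3 < a)%N = false by lia.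
  have -> : (a.+1 < (a + h).+2)%N by lia.
  by rewrite mul1r.
Qed.

Lemma path_series_upper :
  Fps (fun a => path_sum a.+1 a) = catalan y * path_series.
Proof.
pose g h := Fps (fun a => path_sum (a + h) a).
have -> : path_series = g 0%N by apply: fps_ext => a; rewrite /= addn0.
have -> : Fps (fun a => path_sum a.+1 a) = g 1%N.
  by apply: fps_ext => a; rewrite /= addn1.
apply: catalan_ladder => [|h]; apply: fps_ext => -[|a];
  rewrite fps_coefD fps_coefTM ?fps_coefCM /=.
- by rewrite path_sumS0 mul1r add0r.
- rewrite !addnS !addn0 path_sumSS ltnn.
  have -> : (a.+2 < a)%N = false by lia.
  by rewrite !mul1r addrC.
- by rewrite !add0n path_sumS0 add0r expr1.
- rewrite addnS path_sumSS !addnS !addSn.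
  have -> : ((a + h).+3 < a)%N = false by lia.
  have -> : (a.+1 < (a + h).+2)%N by lia.
  by rewrite mul1r addrC.
Qed.

Lemma path_seriesE :
  path_series = 1 + t * ((catalan x + catalan y) * path_series).
Proof.
rewrite mulrDl -path_series_lower -path_series_upper.
apply: fps_ext => -[|n]; rewrite fps_coefD fps_coefTM fps_coef1 /=.
  by rewrite path_sum00 addr0.
(* A step leaving the diagonal has weight 1: E ends below it and N above it. *)
rewrite path_sumSS add0r !ltnNge !leqnSn /=.
by rewrite !mul1r.
Qed.

End PathSum.

(** * Matches of EENN and NNEE as weighted steps *)

(* [p] and [q] count the letters E and N already read. *)
Fixpoint ps_from (A : pred nat) (p q : nat) (L : seq bool) : seq bool :=
  if L is c :: L' then
    if c then (if A p.+1 then [:: c] else [::]) ++ ps_from A p.+1 q L'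
    else (if A q.+1 then [:: c] else [::]) ++ ps_from A p q.+1 L'
  else [::].

Lemma ps_fromE L A : ps L A = ps_from A 0 0 L.
Proof.
(* Generalized for the induction: occurrence numbers are shifted by the letters already read. *)
suff H p q : ps_from A p q L = mask [seq A
    ((if nth stepE L k then p else q) + count_mem (nth stepE L k) (take k.+1 L))%N
    | k <- iota 0 (size L)] L.
  by rewrite H /ps; congr (mask _ _); apply: eq_map => k; case: nth.
elim: L p q => //= c L IHL p q.
rewrite take0 /= eqxx addn0 addn1 -[1%N]/(1 + 0)%N iotaDl -map_comp.
case: c; rewrite IHL; (case: (A _) => /=; [congr (_ :: _)|]);
  congr (mask _ _); apply: eq_map => k /=; congr A;
  by case: nth; rewrite /= ?add0n ?add1n ?addSnnS ?addnS.
Qed.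

Lemma ps_from_negb A p q L :
  ps_from A p q (map negb L) = map negb (ps_from A q p L).
Proof. by elim: L p q => //= -[] L IHL p q /=; rewrite IHL map_cat; case: (A _). Qed.

Lemma ps_from_done j p q (L : seq bool) : (j < p)%N -> (j < q)%N ->
  ps_from (pred2 j j.+1) p q L = [::].
Proof.
elim: L p q => //= c L IHL p q jp jq; rewrite !IHL ?leqW //.
have neq r : (j < r)%N -> (r.+1 == j) || (r.+1 == j.+1) = false by lia.
by rewrite !neq //; case: c.
Qed.

(** Both kept E and the first kept N are past, so only the next N survives. *)
Lemma ps_from_last_N j p (L : seq bool) : (j < p)%N -> (0 < count_mem stepN L)%N ->
  ps_from (pred2 j j.+1) p j L = [:: stepN].
Proof.
elim: L p => //= -[] L IHL p jp /=.
  by move=> L0; rewrite IHL ?leqW // (gtn_eqF (leqW jp)) gtn_eqF.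
by move=> _; rewrite eqxx orbT ps_from_done.
Qed.

(* When [q < j]: the [j+1]-st E comes before the [j]-th N. *)
Fixpoint E_overtakes (j p q : nat) (L : seq bool) : bool :=
  if L is c :: L' then
    if c then E_overtakes j p.+1 q L'
    else if q.+1 == j then (j < p)%N else E_overtakes j p q.+1 L'
  else false.

(* [minn 2 (j.+1 - p)] of the two kept letters E are still to be read. *)
Lemma ps_from_EENN j p q (L : seq bool) : (q < j)%N -> (j < q + count_mem stepN L)%N ->
  (ps_from (pred2 j j.+1) p q L ==
     nseq (minn 2 (j.+1 - p)) stepE ++ [:: stepN; stepN]) = E_overtakes j p q L.
Proof.
elim: L p q => [|[] L IHL] p q qj /=.
- by rewrite addn0 => /(ltn_trans qj); rewrite ltnn.
- rewrite add0n => jN; rewrite -(IHL _ _ qj jN).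
  case: (boolP ((p.+1 == j) || (p.+1 == j.+1))) => pj /=.
    have -> : minn 2 (j.+1 - p) = (minn 2 (j.+1 - p.+1)).+1 by lia.
    by rewrite /= eqseq_cons.
  by have -> : minn 2 (j.+1 - p) = minn 2 (j.+1 - p.+1) by lia.
- rewrite add1n addnS => jN.
  have -> : (q.+1 == j.+1) = false by lia.
  case: (q.+1 =P j) => [qj1|qj1] /=; last by apply: IHL => //; rewrite ltn_neqAle qj andbT; apply/eqP.
  (* At the [j]-th N, either both kept E are past and NN follows, or the expected word still begins
     with E and the match fails. *)
  case: (ltnP j p) => jp.
    have -> : minn 2 (j.+1 - p) = 0%N by lia.
    rewrite qj1 ps_from_last_N ?eqxx //.
    by move: jN; rewrite -qj1 ltnS -[X in (X < _)%N]addn0 ltn_add2l.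
  by have [k ->] : exists k, minn 2 (j.+1 - p) = k.+1
    by exists (minn 2 (j.+1 - p)).-1; lia.
Qed.

(** Since both letters total [n], having read more than [j] letters E at the [j]-th N means that
    fewer E than N remain, which is the test in [lower_steps]. *)
Lemma count_E_overtakes n p q (L : seq bool) :
    (p + count_mem stepE L = n)%N -> (q + count_mem stepN L = n)%N ->
  count (fun j => E_overtakes j p q L) (index_iota q.+1 n) = lower_steps L.
Proof.
elim: L p q => [|c L] /=; first by move=> p q _ _; rewrite count_pred0.
set e := count_mem stepE L; set b := count_mem stepN L => IHL p q.
case: c; rewrite /= add0n => pn qn; first by apply: IHL; lia.
have {}qn : (q.+1 + b = n)%N by lia.
rewrite -(IHL _ _ pn qn).
(* The [n]-th N is outside the range, and [lower_steps] does not count it either, as no N follows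
   it. *)
case: (ltnP q.+1 n) => qn1; last first.
  have -> : (e < b)%N = false by lia.
  by rewrite /index_iota; have [-> ->] : (n - q.+1 = 0)%N /\ (n - q.+2 = 0)%N by lia.
rewrite {1}/index_iota; have -> : (n - q.+1 = (n - q.+2).+1)%N by lia.
rewrite /= eqxx; congr (_ + _)%N; first by congr nat_of_bool; lia.
apply: eq_in_count => j; rewrite mem_iota => /andP[qj _].
by have -> : (q.+1 == j) = false by lia.
Qed.

Lemma count_ps_P1 n (L : seq bool) :
    count_mem stepE L = n -> count_mem stepN L = n ->
  count (fun j => ps L (pred2 j j.+1) == P1) (index_iota 1 n) = lower_steps L.
Proof.
move=> En Nn; rewrite -(@count_E_overtakes n 0 0) //.
apply: eq_in_count => j; rewrite mem_index_iota => /andP[j0 jn].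
rewrite -ps_from_EENN ?Nn // ps_fromE.
by have -> : minn 2 (j.+1 - 0) = 2 by lia.
Qed.

Lemma count_mem_negb b L : count_mem b (map negb L) = count_mem (~~ b) L.
Proof. by rewrite count_map; apply: eq_count => -[]; case: b. Qed.

Lemma upper_steps_negb L : upper_steps L = lower_steps (map negb L).
Proof. by elim: L => //= c L ->; rewrite !count_mem_negb; case: c. Qed.

(** Reflection in the diagonal swaps E and N, reducing this to the case of EENN. *)
Lemma count_ps_P6 n (L : seq bool) :
    count_mem stepE L = n -> count_mem stepN L = n ->
  count (fun j => ps L (pred2 j j.+1) == P6) (index_iota 1 n) = upper_steps L.
Proof.
move=> En Nn; rewrite upper_steps_negb -(@count_ps_P1 n) ?count_mem_negb //.
apply: eq_count => j.
by rewrite !ps_fromE ps_from_negb -[P1]/(map negb P6) (inj_eq (inj_map negb_inj)).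
Qed.

(** * The closed form *)

Lemma F16E : F16 = path_series x1 x6.
Proof.
apply: fps_ext => -[|n]; first by rewrite /= path_sum00.
apply: eq_big => [L|L]; rewrite inE // => /andP[/eqP En /eqP Nn].
by rewrite /path_weight /mch count_ps_P1 // count_ps_P6.
Qed.

(** Substituting the Catalan form of the roots turns the denominator into 2 x y (1 - t (C + D)), and
    [path_seriesE] makes the last factor the inverse of the path series. *)
Lemma path_series_frac (R : idomainType) (x y : R) :
    (2%:R : R) \is a GRing.unit -> x != 0 -> y != 0 ->
  (tofrac (path_series x y) : {fraction fps R}) =
    tofrac (2 * fpsC x * fpsC y) /
    tofrac ((- 1 + fps_sqrt (1 - 4 * fpsC x * fpsT R)) * fpsC y
            + (- 1 + fps_sqrt (1 - 4 * fpsC y * fpsT R)) * fpsC x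
            + 2 * fpsC x * fpsC y).
Proof.
move=> u2 x0 y0; rewrite (fps_sqrt_catalan x u2) (fps_sqrt_catalan y u2).
move: (path_seriesE x y); move: (path_series x y) => F.
move: (catalan x) (catalan y) (fpsT R) => C D t FE.
have -> : (- 1 + (1 - 2 * fpsC x * t * C)) * fpsC y +
    (- 1 + (1 - 2 * fpsC y * t * D)) * fpsC x + 2 * fpsC x * fpsC y =
    2 * fpsC x * fpsC y * (1 - t * (C + D)) by ring.
have {}FE : F * (1 - t * (C + D)) = 1.
  have -> : F * (1 - t * (C + D)) = F - t * ((C + D) * F) by ring.
  by rewrite {1}FE addrK.
have fpsC_neq0 c : c != 0 -> fpsC c != 0.
  by apply: contra_neq => /(congr1 (fun f => fps_coef f 0)).
have two_neq0 : (2 : fps R) != 0.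
  apply/eqP => /(congr1 (fun f => fps_coef f 0)) /= E2.
  by move: u2; rewrite mulr2n E2 unitr0.
have den_neq0 : 1 - t * (C + D) != 0.
  by apply/eqP => E0; move/eqP: FE; rewrite E0 mulr0 eq_sym oner_eq0.
apply: (canRL (mulfK _)).
  by rewrite tofrac_eq0 !mulf_neq0 ?fpsC_neq0.
by rewrite -tofracM mulrCA FE mulr1.
Qed.

Theorem mainTheorem8 :
  let t : fps coefRing := fpsT coefRing in
  let X1 : fps coefRing := fpsC x1 in
  let X6 : fps coefRing := fpsC x6 in
  (tofrac F16 : {fraction fps coefRing}) =
    tofrac (2 * X1 * X6) /
    tofrac ((- 1 + fps_sqrt (1 - 4 * X1 * t)) * X6
            + (- 1 + fps_sqrt (1 - 4 * X6 * t)) * X1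
            + 2 * X1 * X6).
Proof.
have X_neq0 (i : 'I_2) : ('X_i : coefRing) != 0.
  by rewrite -msize_poly_eq0 msizeX.
have u2 : (2%:R : coefRing) \is a GRing.unit.
  apply/unitrPr; exists (2%:R^-1)%:MP_[2].
  by rewrite -mpolyC_nat -mpolyCM divff.
by rewrite F16E; apply: path_series_frac; rewrite ?X_neq0.
Qed.
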